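(* Let $p$ be a prime and let $\mathcal{G}=(G,\theta)$ be a finitely generated torsion free cyclotomic pro-$p$ pair. Then $\mathcal{G}$ is Kummerian if and only if \[K(\mathcal{G})=\bigcap_c c^{-1}(\{0\}),\] where $c$ ranges over all continuous 1-cocycles $c\colon G\to\mathbb{Z}_p(1)_\theta$.
   Context: A cyclotomic pro-$p$ pair is a pair $(G,\theta)$ with $G$ a pro-$p$ group and $\theta\colon G\to 1+p\mathbb{Z}_p$ a continuous homomorphism; finitely generated means $G$ is finitely generated as a pro-$p$ group; torsion free means $\mathrm{Im}(\theta)$ is torsion free. $K(\mathcal{G})$ is the closed subgroup of $G$ generated by all $h^{-\theta(g)}ghg^{-1}$ with $g\in G$, $h\in\mathrm{Ker}(\theta)$; the pair is Kummerian if $\mathrm{Ker}(\theta)/K(\mathcal{G})$ is a free abelian pro-$p$ group. $\mathbb{Z}_p(1)_\theta$ is the $G$-module $\mathbb{Z}_p$ with $g\cdot\alpha=\theta(g)\alpha$; a continuous 1-cocycle is a continuous map $c\colon G\to\mathbb{Z}_p$ with $c(gh)=c(g)+\theta(g)c(h)$ for all $g,h\in G$. *)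

(* Defs.v *)
From HB Require Import structures.
From mathcomp Require Import all_boot all_order all_algebra.
From mathcomp Require Import all_classical all_reals all_analysis.

Set Implicit Arguments.
Unset Strict Implicit.
Unset Printing Implicit Defensive.

Import GRing.Theory.

Local Open Scope classical_set_scope.
Local Open Scope ring_scope.

Section PadicInt.
Variable p : nat.

Definition padic_red (n : nat) (x : 'Z_(p ^ n.+2)) : 'Z_(p ^ n.+1) :=
  (x : nat)%:R.

Definition padic_coherent (x : forall n, 'Z_(p ^ n.+1)) : Prop :=
  forall n, padic_red (x n.+1) = x n.

(** The inverse limit of the rings [Z/p^(n+1)], [n : nat].  The index is shifted
    because ['Z_1] is not the zero ring in MathComp; for prime [p] every
    ['Z_(p ^ n.+1)] has exactly [p ^ n.+1] elements. *)
Record padic := Padic {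
  padic_proj :> forall n, 'Z_(p ^ n.+1);
  padic_projP : padic_coherent padic_proj }.

Lemma padic_ext (x y : padic) : (forall n, x n = y n) -> x = y.
Proof.
case: x y => [x cx] [y cy] /= exy.
have {}exy : x = y by apply: functional_extensionality_dep.
by case: y / exy cy => cy; rewrite (Prop_irrelevance cx cy).
Qed.

HB.instance Definition _ := gen_eqMixin padic.
HB.instance Definition _ := gen_choiceMixin padic.

Lemma padic_red_nat n (k : nat) : padic_red (k%:R : 'Z_(p ^ n.+2)) = k%:R.
Proof.
rewrite /padic_red; apply: val_inj => /=.
rewrite !Zp_nat /= modn_dvdm //.
case: (ltnP 1 p) => [p_gt1 | ].
  by rewrite !Zp_cast ?ltn_exp1r ?(ltn_exp2l 0) // dvdn_exp2l.
by case: p => [|[|]] //; rewrite ?exp0n ?exp1n.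
Qed.

Lemma padic_red_is_nmod n : {morph @padic_red n : x y / x + y}.
Proof.
move=> x y; rewrite -(natr_Zp x) -(natr_Zp y) -natrD.
by rewrite !padic_red_nat natrD.
Qed.

Lemma padic_red_is_multiplicative n : {morph @padic_red n : x y / x * y}.
Proof.
move=> x y; rewrite -(natr_Zp x) -(natr_Zp y) -natrM.
by rewrite !padic_red_nat natrM.
Qed.

Lemma padic_red0 n : @padic_red n 0 = 0.
Proof. exact: (padic_red_nat n 0). Qed.

Lemma padic_red1 n : @padic_red n 1 = 1.
Proof. exact: (padic_red_nat n 1). Qed.

Lemma padic_redN n : {morph @padic_red n : x / - x}.
Proof.
move=> x; apply/eqP; rewrite -addr_eq0 -padic_red_is_nmod addNr.
by rewrite padic_red0.
Qed.

Definition padic0 := Padic (fun n => padic_red0 n).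
Definition padic1 := Padic (fun n => padic_red1 n).

Fact padic_opp_subproof (x : padic) : padic_coherent (fun n => - x n).
Proof. by move=> n; rewrite padic_redN padic_projP. Qed.
Definition padic_opp x := Padic (padic_opp_subproof x).

Fact padic_add_subproof (x y : padic) : padic_coherent (fun n => x n + y n).
Proof. by move=> n; rewrite padic_red_is_nmod !padic_projP. Qed.
Definition padic_add x y := Padic (padic_add_subproof x y).

Fact padic_mul_subproof (x y : padic) : padic_coherent (fun n => x n * y n).
Proof. by move=> n; rewrite padic_red_is_multiplicative !padic_projP. Qed.
Definition padic_mul x y := Padic (padic_mul_subproof x y).

Fact padic_addA : associative padic_add.
Proof. by move=> x y z; apply: padic_ext => n /=; rewrite addrA. Qed.
Fact padic_addC : commutative padic_add.
Proof. by move=> x y; apply: padic_ext => n /=; rewrite addrC. Qed.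
Fact padic_add0 : left_id padic0 padic_add.
Proof. by move=> x; apply: padic_ext => n /=; rewrite add0r. Qed.
Fact padic_addN : left_inverse padic0 padic_opp padic_add.
Proof. by move=> x; apply: padic_ext => n /=; rewrite addNr. Qed.

HB.instance Definition _ :=
  GRing.isZmodule.Build padic padic_addA padic_addC padic_add0 padic_addN.

Fact padic_mulA : associative padic_mul.
Proof. by move=> x y z; apply: padic_ext => n /=; rewrite mulrA. Qed.
Fact padic_mulC : commutative padic_mul.
Proof. by move=> x y; apply: padic_ext => n /=; rewrite mulrC. Qed.
Fact padic_mul1 : left_id padic1 padic_mul.
Proof. by move=> x; apply: padic_ext => n /=; rewrite mul1r. Qed.
Fact padic_mulDl : left_distributive padic_mul padic_add.
Proof. by move=> x y z; apply: padic_ext => n /=; rewrite mulrDl. Qed.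
Fact padic_1_neq0 : padic1 != padic0.
Proof. by apply/eqP => /(congr1 (fun x : padic => x 0)) /eqP; rewrite oner_eq0. Qed.

HB.instance Definition _ := GRing.Zmodule_isComNzRing.Build padic
  padic_mulA padic_mulC padic_mul1 padic_mulDl padic_1_neq0.

(** The p-adic topology: the sets [x + p^(n+1) Z_p] form a neighbourhood basis
    at [x]. *)
Definition padic_nbhs (x : padic) : set_system padic :=
  filter_from [set: nat] (fun n => [set y : padic | y n = x n]).

HB.instance Definition _ := hasNbhs.Build padic padic_nbhs.

Lemma padic_proj_le (x y : padic) m n : (m <= n)%N -> x n = y n -> x m = y m.
Proof.
move=> /subnK <-; elim: (n - m)%N => [//|k IHk].
rewrite addSn => exy; apply: IHk.
by rewrite -(padic_projP x) -(padic_projP y) exy.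
Qed.

Fact padic_nbhs_filter (x : padic) : ProperFilter (nbhs x).
Proof.
apply: filter_from_proper; last by move=> n _; exists x.
apply: filter_from_filter; first by exists 0%N.
move=> m n _ _; exists (maxn m n) => // y /= exy.
by split; apply: padic_proj_le exy; rewrite ?leq_maxl ?leq_maxr.
Qed.

Fact padic_nbhs_singleton (x : padic) (A : set padic) : nbhs x A -> A x.
Proof. by case=> n _; apply. Qed.

Fact padic_nbhs_nbhs (x : padic) (A : set padic) :
  nbhs x A -> nbhs x (nbhs^~ A).
Proof.
case=> n _ sA; exists n => // y /= exy; exists n => // z /= ezy.
by apply: sA => /=; rewrite ezy.
Qed.

HB.instance Definition _ := Nbhs_isNbhsTopological.Build padic
  padic_nbhs_filter padic_nbhs_singleton padic_nbhs_nbhs.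

End PadicInt.

HB.mixin Record Group_isTopological G & Topological G & Group G := {
  mulg_continuous : continuous (fun xy : G * G => (xy.1 * xy.2)%g);
  invg_continuous : continuous (fun x : G => (x^-1)%g)
}.

#[short(type="topGroupType")]
HB.structure Definition TopGroup :=
  {G of Topological G & Group G & Group_isTopological G}.

Section TopGroup.
Variable G : topGroupType.
Implicit Types H N : set G.

Definition is_subgroup H : Prop :=
  H 1%g /\ forall x y, H x -> H y -> H (x / y)%g.

Definition is_normal N : Prop := forall x g, N x -> N (x ^ g)%g.

Definition left_coset N (x : G) : set G := [set (x * y)%g | y in N].

Definition left_cosets H N : set (set G) := [set left_coset N x | x in H].

Definition closed_subgroup_gen (S : set G) : set G :=
  smallest [set H | is_subgroup H /\ closed H] S.

Definition is_profinite : Prop :=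
  [/\ compact [set: G], hausdorff_space G & totally_disconnected [set: G]].

Definition is_pro_p (p : nat) : Prop :=
  is_profinite /\
  forall N, is_subgroup N -> is_normal N -> open N ->
    exists k : nat, (left_cosets [set: G] N #= `I_(p ^ k))%card.

Definition topologically_finitely_generated : Prop :=
  exists s : seq G, closed_subgroup_gen [set` s] = [set: G].

(** The p-adic power [h ^ a]: the limit of [h ^ a_n], where [a_n : nat] is the
    residue of [a] modulo [p ^ n.+1].  In a pro-p group this limit exists and
    is unique. *)
Definition padic_expg (p : nat) (h : G) (a : padic p) : G :=
  xget 1%g [set y : G | (fun n => h ^+ (a n : nat))%g @ \oo --> y].

(** [H / N] is a free abelian pro-p group, i.e. isomorphic as a topological
    group to [Z_p^I] for some set [I].  The isomorphism [F] is defined on the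
    set of cosets [x N], [x] in [H]; it is a homeomorphism for the quotient
    topology: a set of cosets is open when its union is open in [H]. *)
Definition quotient_free_abelian_pro_p (p : nat) H N : Prop :=
  exists (I : Type) (F : set G -> {ptws I -> padic p}),
    [/\ set_bij (left_cosets H N) [set: {ptws I -> padic p}] F,
        forall x y, H x -> H y -> forall i,
          F (left_coset N (x * y)%g) i =
          F (left_coset N x) i + F (left_coset N y) i &
        forall V : set {ptws I -> padic p},
          open V <->
          open ([set x | H x /\ V (F (left_coset N x))] : set (subspace H))].

End TopGroup.

Section CyclotomicPair.
Variables (p : nat) (G : topGroupType) (theta : G -> padic p).

(** Since [1 + p Z_p] carries the subspace topology, continuity into it is
    continuity into [Z_p]. *)
Definition cyclotomic_pro_p_pair : Prop :=
  [/\ is_pro_p G p,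
      forall g, exists a : padic p, theta g = 1 + p%:R * a,
      forall g h, theta (g * h)%g = theta g * theta h &
      continuous theta].

Definition pair_torsion_free : Prop :=
  forall (a : padic p) (n : nat),
    range theta a -> (0 < n)%N -> a ^+ n = 1 -> a = 1.

Definition pair_ker : set G := [set h | theta h = 1].

Definition pair_K : set G :=
  closed_subgroup_gen
    [set (padic_expg h (- theta g) * g * h * g^-1)%g
       | g in [set: G] & h in pair_ker].

Definition kummerian : Prop :=
  quotient_free_abelian_pro_p p pair_ker pair_K.

Definition continuous_cocycle (c : G -> padic p) : Prop :=
  continuous c /\ forall g h, c (g * h)%g = c g + theta g * c h.

End CyclotomicPair.

(* Main.v *)
Require Import Defs.
From mathcomp Require Import all_boot all_order all_algebra.
From mathcomp Require Import all_classical all_reals all_analysis.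

(** Every continuous cocycle [c] restricts to a homomorphism on [Ker theta] that
    vanishes on [K], since [c (g h g^-1) = theta g * c h] for [h] in the kernel.
    Conversely a continuous homomorphism [f] on [Ker theta] that vanishes on [K]
    is equivariant, so either [theta = 1] and [f] is a cocycle, or
    [theta g0 <> 1] for some [g0] and [g |-> f [g, g0]] is a cocycle restricting
    to [(1 - theta g0) f]; hence the coordinates of a free quotient
    [Ker theta / K] are detected by cocycles.  If [K] is the common zero set of
    the cocycles, then finitely many of them suffice because a cocycle is
    determined by its values at topological generators, and dividing by values
    of minimal valuation replaces them by homomorphisms on [Ker theta] with the
    same common kernel that are jointly surjective onto some [Z_p^I]. *)

Set Implicit Arguments.
Unset Strict Implicit.
Unset Printing Implicit Defensive.

Import GRing.Theory.

Local Open Scope classical_set_scope.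
Local Open Scope ring_scope.

(** * Divisibility and cancellation in [Z_p] *)

Section PadicArithmetic.
Variables (p : nat) (p_prime : prime p).
Implicit Types (a b c x y : padic p) (m n k : nat).

Lemma padic_projD x y n : (x + y) n = x n + y n. Proof. by []. Qed.
Lemma padic_projN x n : (- x) n = - x n. Proof. by []. Qed.
Lemma padic_projM x y n : (x * y) n = x n * y n. Proof. by []. Qed.
Lemma padic_proj0 n : (0 : padic p) n = 0. Proof. by []. Qed.
Lemma padic_proj1 n : (1 : padic p) n = 1. Proof. by []. Qed.

Lemma padic_proj_nat k n : (k%:R : padic p) n = k%:R.
Proof. by elim: k => // k IHk; rewrite -natr1 padic_projD IHk -natr1. Qed.

Lemma expn_prime_gt1 n : (1 < p ^ n.+1)%N.
Proof. by rewrite -(exp1n n.+1) ltn_exp2r // prime_gt1. Qed.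

Lemma padic_nat_eq0 n k : ((k%:R : 'Z_(p ^ n.+1)) == 0) = (p ^ n.+1 %| k)%N.
Proof. by rewrite -val_eqE /= Zp_nat /= Zp_cast ?expn_prime_gt1. Qed.

Lemma padic_val_modn x n : (x n : nat) = ((x n.+1 : nat) %% p ^ n.+1)%N.
Proof.
rewrite -{1}(padic_projP x) /padic_red Zp_nat /=.
by congr (_ %% _)%N; apply/Zp_cast/expn_prime_gt1.
Qed.

Lemma padic_val_modX a m n : (m <= n)%N ->
  (a m : nat) = ((a n : nat) %% p ^ m.+1)%N.
Proof.
move=> /subnK <-; elim: (n - m)%N => [|k IHk].
  rewrite modn_small //; apply: leq_trans (ltn_ord _) _.
  by rewrite Zp_cast ?expn_prime_gt1.
rewrite addSn IHk padic_val_modn modn_dvdm // dvdn_exp2l //.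
by rewrite ltnS leq_addl.
Qed.

(** Multiplication by [p] raises the valuation by one, which is a shift of the level. *)
Lemma padic_mulp_eq0 x n : ((p%:R * x) n.+1 == 0) = (x n == 0).
Proof.
rewrite padic_projM padic_proj_nat -(natr_Zp (x n.+1)) -natrM padic_nat_eq0.
rewrite -(padic_projP x n) /padic_red padic_nat_eq0.
by move: (nat_of_ord _) => k; rewrite expnS dvdn_pmul2l ?prime_gt0.
Qed.

Lemma padic_dvdp_val x n : (p %| x n)%N = (x 0%N == 0).
Proof.
elim: n => [|n <-].
  rewrite -[X in _ = (X == _)]natr_Zp padic_nat_eq0.
  by move: (nat_of_ord _) => k; rewrite expn1.
rewrite (padic_val_modn x n); move: (nat_of_ord _) => k.
by rewrite /dvdn modn_dvdm // expnS dvdn_mulr.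
Qed.

(** Floor division by [p] drops the lowest digit and is coherent for every [x]: a multiple of
    [p ^ n.+2] contributes a multiple of [p ^ n.+1] to the quotient, which is zero in the target. *)
Fact padic_divp_subproof x :
  padic_coherent (fun n => ((x n.+1 : nat) %/ p)%:R : 'Z_(p ^ n.+1)).
Proof.
move=> n; rewrite padic_red_nat.
rewrite [in RHS]padic_val_modn; move: (nat_of_ord _) => k.
have -> : (k %/ p = k %/ p ^ n.+2 * p ^ n.+1 + (k %% p ^ n.+2) %/ p)%N.
  rewrite {1}(divn_eq k (p ^ n.+2)) {2}expnS mulnCA divnDl ?dvdn_mulr //.
  by rewrite mulKn ?prime_gt0.
rewrite natrD natrM.
have /eqP -> : ((p ^ n.+1)%:R : 'Z_(p ^ n.+1)) == 0 by rewrite padic_nat_eq0.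
by rewrite mulr0 add0r.
Qed.

Definition padic_divp x := Padic (padic_divp_subproof x).

Lemma padic_divpK x : x 0%N = 0 -> p%:R * padic_divp x = x.
Proof.
move=> x0; apply: padic_ext => n.
rewrite padic_projM padic_proj_nat /= -natrM mulnC divnK.
  exact: padic_projP.
by rewrite padic_dvdp_val x0.
Qed.

(** The levelwise inverses are coherent because reduction is multiplicative. *)
Lemma padic_unit x : x 0%N != 0 -> exists y, y * x = 1.
Proof.
move=> x0; have ux n : x n \is a GRing.unit.
  rewrite -(natr_Zp (x n)) unitZpE ?expn_prime_gt1 // coprimeXl //.
  by rewrite prime_coprime // padic_dvdp_val.
have cx : padic_coherent (fun n => (x n)^-1 : 'Z_(p ^ n.+1)).
  move=> n; apply: (mulIr (ux n)); rewrite mulVr ?ux //.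
  rewrite -[X in _ * X = _](padic_projP x) -padic_red_is_multiplicative.
  by rewrite mulVr ?ux // padic_red1.
by exists (Padic cx); apply: padic_ext => n; rewrite padic_projM /= mulVr ?ux.
Qed.

(** The valuation of [a] is at most [n], so cancelling [a] costs at most [n] levels. Either [a] is a
    unit, or it is divided by [p] and [n] drops by one. *)
Lemma padic_mul_eq0 a n : a n != 0 ->
  forall x m, (x * a) (m + n)%N = 0 -> x m = 0.
Proof.
elim: n a => [|n IHn] a an0 x m xa.
  have [y ya] := padic_unit an0.
  rewrite -(mulr1 x) -ya (mulrC y) mulrA padic_projM.
  by move: xa; rewrite addn0 => ->; rewrite mul0r.
have [a0|a0] := eqVneq (a 0%N) 0; last first.
  have [y ya] := padic_unit a0.
  have {}xa : x (m + n.+1)%N = 0.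
    by rewrite -(mulr1 x) -ya (mulrC y) mulrA padic_projM xa mul0r.
  apply: (@padic_proj_le p x 0 m (m + n.+1)); last exact: xa.
  exact: leq_addr.
have ea := padic_divpK a0; apply: (IHn (padic_divp a)).
  by rewrite -padic_mulp_eq0 ea.
by apply/eqP; rewrite -padic_mulp_eq0 mulrCA ea -addnS xa.
Qed.

Lemma padic_neq0P x : x <> 0 -> exists n, x n != 0.
Proof.
move=> x0; apply: contrapT => xn; apply: x0; apply: padic_ext => n.
by apply/eqP/negP => xn0; apply: xn; exists n; apply/negP.
Qed.

Lemma padic_mulf_eq0 x a : a <> 0 -> x * a = 0 -> x = 0.
Proof.
move=> /padic_neq0P[n an] xa; apply: padic_ext => m.
by apply: (padic_mul_eq0 an); rewrite xa.
Qed.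

Lemma padic_mulIf x y a : a <> 0 -> x * a = y * a -> x = y.
Proof.
move=> a0 e; apply: subr0_eq; apply: (padic_mulf_eq0 a0).
by rewrite mulrBl e subrr.
Qed.

(** Here [a] has valuation exactly [n] and [b] at least [n]; both are divided by [p] until [a] is a
    unit. *)
Lemma padic_dvd a b n : a n != 0 ->
  (forall m, (m < n)%N -> a m = 0) -> (forall m, (m < n)%N -> b m = 0) ->
  exists c, b = c * a.
Proof.
elim: n a b => [|n IHn] a b an am bm.
  by have [y ya] := padic_unit an; exists (b * y); rewrite -mulrA ya mulr1.
have ea := padic_divpK (am 0%N isT); have eb := padic_divpK (bm 0%N isT).
have [|||c ec] := IHn (padic_divp a) (padic_divp b).
- by rewrite -padic_mulp_eq0 ea.
- by move=> m mn; apply/eqP; rewrite -padic_mulp_eq0 ea am.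
- by move=> m mn; apply/eqP; rewrite -padic_mulp_eq0 eb bm.
by exists c; rewrite -eb ec mulrCA ea.
Qed.

End PadicArithmetic.

(** * Clopen separation in compact Hausdorff totally disconnected spaces *)

Section TotallyDisconnected.
Variable T : topologicalType.

Let clopens (x : T) := [set D : set T | D x /\ clopen D].

Let clopens_filter x : ProperFilter (filter_from (clopens x) id).
Proof.
apply: filter_from_proper; last by move=> A [Ax _]; exists x.
apply: filter_from_filter; first by exists setT; split => //; exact: clopenT.
move=> A B [? ?] [? ?]; exists (A `&` B) => //; split => //; exact: clopenI.
Qed.

(** Otherwise the clopen neighbourhoods of [x] trace a proper filter on the compact complement of
    [O], and a cluster point of it lies in all of them but outside [O]. *)
Let clopen_in_open x (O : set T) : compact [set: T] -> open O ->
  \bigcap_(D in clopens x) D `<=` O ->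
  exists2 W, clopens x W & W `<=` O.
Proof.
move=> cT oO sO; apply: contrapT => nW; have CF := clopens_filter x.
have cO : compact (~` O) by apply: (subclosed_compact _ cT); first exact: open_closedC.
pose F := within (~` O) (filter_from (clopens x) id).
have FF : ProperFilter F.
  apply: Build_ProperFilter_ex => P [W cW WP]; apply: contrapT => nP.
  apply: nW; exists W => // y Wy; apply: contrapT => nOy.
  by apply: nP; exists y; apply: WP.
have [] := cO F FF; first by exists setT => //; split => //; exact: clopenT.
move=> y [nOy cy]; apply: nOy; apply: sO => D cD; apply: contrapT => nDy.
have [||z [Dz nDz]] := cy D (~` D); last exact: nDz.
- by exists D.
- by apply: open_nbhs_nbhs; split => //; apply/closed_openC; case: cD => _ [].
Qed.

(* The intersection of the clopen neighbourhoods of [x] is connected. *)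
Lemma compact_totally_disconnected_zero_dimensional :
  compact [set: T] -> hausdorff_space T -> totally_disconnected [set: T] ->
  zero_dimensional T.
Proof.
move=> cT hT tdT x y /eqP xy; pose Q := \bigcap_(D in clopens x) D.
have Qx : Q x by move=> D [].
have clQ : closed Q by apply: closed_bigI => D [_ []].
have conQ : connected Q.
  (* [B] is clopen in [Q], so normality separates [B] from the rest of [Q] by disjoint open sets [U]
     and [V]. A clopen [W] around [x] inside their union splits into two clopen pieces, and the
     piece containing [x] contains [Q]. As [B] is nonempty, this is the piece in [U], whence
     [B = Q]. *)
  move=> B [b Bb] [C oC BC] [D cD BD].
  have clB : closed B by rewrite BD; exact: closedI.
  have clQB : closed (Q `&` ~` C) by apply: closedI => //; exact: open_closedC.
  have nB : set_nbhs B (~` (Q `&` ~` C)).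
    apply/set_nbhsP; exists (~` (Q `&` ~` C)); split => //; first exact: closed_openC.
    by rewrite {1}BC => z [_ Cz] [_ /(_ Cz)].
  have [U0 /set_nbhsP[U [oU BU UU0]] clU0] := compact_normal hT cT clB nB.
  pose V := ~` closure U.
  have oV : open V by apply/closed_openC/closed_closure.
  have QUV : Q `<=` U `|` V.
    move=> z Qz; have [Cz|nCz] := pselect (C z).
      by left; apply: BU; rewrite BC.
    by right => /(closureS UU0)/clU0; apply.
  have UV z : U z -> V z -> False by move=> /subset_closure Uz; apply.
  have [W cW WUV] := clopen_in_open cT (openU oU oV) QUV.
  case: cW => Wx [oW cW].
  have cpartU : clopen (W `&` U).
    split; first exact: openI.
    have -> : W `&` U = W `&` ~` V.
      apply/seteqP; split => z [Wz]; first by move=> /UV Uz; split.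
      by move=> nVz; split => //; case: (WUV _ Wz).
    by apply: closedI => //; exact: open_closedC.
  have cpartV : clopen (W `&` V).
    split; first exact: openI.
    have -> : W `&` V = W `&` ~` U.
      apply/seteqP; split => z [Wz]; first by move=> Vz; split => // /UV; apply.
      by move=> nUz; split => //; case: (WUV _ Wz).
    by apply: closedI => //; exact: open_closedC.
  have Qb : Q b by move: Bb; rewrite BC => -[].
  have [Ux|Vx] := WUV _ Wx.
    apply/seteqP; split; first by rewrite BC => z [].
    move=> z Qz; rewrite BC; split => //; apply: contrapT => nCz.
    have [_ Uz] := Qz _ (conj (conj Wx Ux) cpartU).
    by have := clU0 _ (closureS UU0 (subset_closure Uz)); apply.
  have [_ Vb] := Qb _ (conj (conj Wx Vx) cpartV).
  by have := UV _ (BU _ Bb) Vb.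
apply: contrapT => nU; apply: xy; apply/esym.
have : connected_component [set: T] x y.
  apply: (connected_component_max Qx) => //.
  move=> D cD; apply: contrapT => nDy; apply: nU; exists D.
  by case: cD.
by rewrite tdT.
Qed.

End TotallyDisconnected.

(** * Topological groups and open normal subgroups of profinite groups *)

Section TopologicalGroup.
Variable G : topGroupType.
Implicit Types (H N : set G) (g h x y : G).

Lemma subgroup1 H : is_subgroup H -> H 1%g. Proof. by case. Qed.

Lemma subgroupV H x : is_subgroup H -> H x -> H (x^-1)%g.
Proof. by move=> [H1 HB] Hx; rewrite -(mul1g (x^-1)%g); apply: HB. Qed.

Lemma subgroupM H x y : is_subgroup H -> H x -> H y -> H (x * y)%g.
Proof.
by move=> sH Hx Hy; rewrite -(invgK y); apply: sH.2 => //; exact: subgroupV.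
Qed.

Lemma subgroupX H x n : is_subgroup H -> H x -> H (x ^+ n)%g.
Proof.
move=> sH Hx; elim: n => [|n IHn]; first exact: subgroup1.
by rewrite expgS; exact: subgroupM.
Qed.

Lemma left_cosetP N x y : is_subgroup N ->
  left_coset N x = left_coset N y <-> N (x^-1 * y)%g.
Proof.
move=> sN; split=> [e|Nxy].
  have : left_coset N y y by exists 1%g; [exact: subgroup1|rewrite mulg1].
  by rewrite -e => -[z Nz <-]; rewrite mulKg.
apply/seteqP; split=> _ [z Nz <-].
  exists (y^-1 * x * z)%g; last by rewrite !mulgA mulgV mul1g.
  apply: subgroupM => //.
  by rewrite -(invgK x) -invgM; exact: subgroupV.
by exists (x^-1 * y * z)%g; [exact: subgroupM | rewrite !mulgA mulgV mul1g].
Qed.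

Lemma cvg_mulg T (F : set_system T) {FF : Filter F} (f g : T -> G) (a b : G) :
  f @ F --> a -> g @ F --> b -> (fun t => f t * g t)%g @ F --> (a * b)%g.
Proof.
move=> fa gb.
have fg : (fun t => (f t, g t)) @ F --> (a, b) by exact: cvg_pair.
exact: (cvg_comp _ _ fg (@mulg_continuous G (a, b))).
Qed.

Lemma cvg_invg T (F : set_system T) {FF : Filter F} (f : T -> G) (a : G) :
  f @ F --> a -> (fun t => (f t)^-1)%g @ F --> (a^-1)%g.
Proof. by move=> fa; exact: (cvg_comp _ _ fa (@invg_continuous G a)). Qed.

Lemma nbhs_mulg g (A : set G) : nbhs 1%g A -> \forall x \near g, A (g^-1 * x)%g.
Proof.
move=> A1; have : (fun x => g^-1 * x)%g @ g --> (g^-1 * g)%g.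
  by apply: cvg_mulg; [exact: cvg_cst|exact: cvg_id].
by rewrite mulVg; apply.
Qed.

Lemma subgroup_open N : is_subgroup N -> nbhs 1%g N -> open N.
Proof.
move=> sN N1; rewrite openE => g Ng; apply: filterS (nbhs_mulg g N1) => x Nx.
by rewrite -(mulVKg g x); exact: subgroupM.
Qed.

(* The subgroup is the set of [g] whose insertion anywhere in a product leaves
   membership in a given clopen set unchanged. *)
Lemma profinite_open_normal (A : set G) : is_profinite G -> nbhs 1%g A ->
  exists N, [/\ is_subgroup N, is_normal N, open N & N `<=` A].
Proof.
move=> [cG hG tdG] A1.
have zG := compact_totally_disconnected_zero_dimensional cG hG tdG.
have [U [U1 [oU clU]] UA] := zero_dimensional_cvg hG zG cG A1.
pose N := [set g | forall x y, U (x * g * y)%g <-> U (x * y)%g].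
have sN : is_subgroup N.
  split=> [x y|g h Ng Nh x y]; first by rewrite mulg1.
  have := Nh x (h^-1 * y)%g; rewrite !mulgA mulgK => ->.
  by have := Ng x (h^-1 * y)%g; rewrite !mulgA.
exists N; split => //.
- move=> g h Ng x y; rewrite conjgE.
  have := Ng (x * h^-1)%g (h * y)%g; rewrite !mulgA => ->.
  by rewrite mulgVK.
- apply: subgroup_open => //.
  (* Compactness of [G * G] gives one neighbourhood of [1] that works for all insertion places
     [(x, y)] at once. *)
  have cGG : compact [set: G * G] by rewrite -setXTT; exact: compact_setX.
  pose P g (xy : G * G) := U (xy.1 * g * xy.2)%g <-> U (xy.1 * xy.2)%g.
  have : \forall g \near (1%g : G), [set: G * G] `<=` P g.
    apply: (iffLR (compact_near_coveringP _) cGG) => -[x y] _.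
    pose F := nbhs ((x, y), 1%g : G).
    have FF : Filter F by exact: nbhs_filter.
    have cx : (fun z : (G * G) * G => z.1.1) @ F --> x.
      exact: (cvg_comp (fst : (G * G) * G -> _) fst cvg_fst cvg_fst).
    have cy : (fun z : (G * G) * G => z.1.2) @ F --> y.
      exact: (cvg_comp (fst : (G * G) * G -> _) snd cvg_fst cvg_snd).
    have cg : (fun z : (G * G) * G => z.2) @ F --> 1%g by exact: cvg_snd.
    have cl := [elaborate cvg_mulg (cvg_mulg cx cg) cy]; rewrite mulg1 in cl.
    have cr := [elaborate cvg_mulg cx cy].
    have [Uxy|nUxy] := pselect (U (x * y)%g).
      have nU := open_nbhs_nbhs (conj oU Uxy).
      by refine (@filterS _ F FF _ _ _ (@filterI _ F FF _ _ (cl _ nU) (cr _ nU))) => z [].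
    have nU := open_nbhs_nbhs (conj (closed_openC clU) nUxy).
    by refine (@filterS _ F FF _ _ _ (@filterI _ F FF _ _ (cl _ nU) (cr _ nU))) => z [].
  by apply: filterS => g Pg x y; exact: (Pg (x, y) I).
- by move=> g Ng; apply: UA; have := Ng 1%g 1%g; rewrite !mul1g mulg1 => ->.
Qed.
End TopologicalGroup.

(* All orbits of a semiregular permutation have the same size. *)
Lemma semiregular_iter_card (T : finType) (f : T -> T) :
  injective f -> (forall m x y, iter m f x = x -> iter m f y = y) ->
  forall x, iter #|T| f x = x.
Proof.
move=> f_inj f_sr x.
(* If the orbit of [y] were longer than that of [z], iterating [order f z] times would fix [z],
   hence [y], before the orbit of [y] closes. *)
have le_order y z : (fingraph.order f y <= fingraph.order f z)%N.
  rewrite leqNgt; apply/negP => /(findex_iter (f := f)).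
  rewrite (f_sr _ _ _ (iter_order f_inj z)) findex0 => /esym/eqP.
  by rewrite -leqn0 leqNgt order_gt0.
have sT : T \subset order_set f (fingraph.order f x).
  by apply/fintype.subsetP => y _; rewrite inE eqn_leq !le_order.
rewrite -(fcard_order_set f_inj sT) //.
rewrite mulnC; elim: (fcard _ _) => [|k IHk]; first by rewrite muln0.
by rewrite mulnS iterD IHk (iter_order f_inj).
Qed.

(** * Convergence of p-adic powers in a pro-p group *)

Section ProPGroup.
Variables (p : nat) (p_prime : prime p) (G : topGroupType).
Hypothesis G_pro_p : is_pro_p G p.
Implicit Types (N : set G) (g h x y : G) (a b : padic p).

(** Left multiplication by [h] permutes the [p ^ k] cosets of [N]. By normality, an iterate that
    fixes one coset fixes them all, so [semiregular_iter_card] applies. *)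
Lemma pro_p_expg_open_normal N h : is_subgroup N -> is_normal N -> open N ->
  exists k, N (h ^+ (p ^ k))%g.
Proof.
move=> sN nN oN; have [k] := G_pro_p.2 N sN nN oN.
move=> /card_set_bijP[c [c_fun c_inj c_surj]]; exists k.
(* The action is carried over to the finite type ['I_(p ^ k)], where orbits can be counted. *)
pose rep (i : 'I_(p ^ k)) := xget 1%g [set x | c (left_coset N x) = i].
have cP x : (c (left_coset N x) < p ^ k)%N.
  by apply: (c_fun (left_coset N x)); exists x.
pose e x := Ordinal (cP x).
have eP x y : e x = e y <-> N (x^-1 * y)%g.
  rewrite -left_cosetP //; split=> [[exy]|exy]; last by apply: val_inj; rewrite /= exy.
  by apply: c_inj exy; apply: mem_set; [exists x|exists y].
have repK i : e (rep i) = i.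
  apply: val_inj => /=; rewrite /rep; case: xgetP => [x _ //|/= nx].
  by have [_ [x _ <-] /nx] := c_surj i (ltn_ord i).
pose f i := e (h * rep i)%g.
have feE x : f (e x) = e (h * x)%g.
  by apply/eP; rewrite invgM mulgA mulgVK; apply/eP/repK.
have iterE m x : iter m f (e x) = e (h ^+ m * x)%g.
  by elim: m => [|m IHm]; rewrite ?mul1g //= IHm feE mulgA -expgS.
have fixE m x : iter m f (e x) = e x <-> N (h ^+ m)%g.
  rewrite iterE; split=> [/esym/eP/nN|Nhm]; last first.
    by apply/esym/eP; have := nN _ x Nhm; rewrite conjgE.
  by move=> /(_ (x^-1)%g); rewrite conjgE invgK !mulgA mulgV mul1g mulgK.
have f_inj : injective f.
  move=> i j; rewrite -(repK i) -(repK j) !feE => /eP.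
  by rewrite invgM -mulgA mulKg => /eP.
have f_sr m i j : iter m f i = i -> iter m f j = j.
  by rewrite -(repK i) -(repK j) => /fixE Nhm; apply/fixE.
by have := semiregular_iter_card f_inj f_sr (e 1%g); rewrite card_ord => /fixE.
Qed.

(** Compactness provides a cluster point. The sequence is eventually constant modulo every open
    normal subgroup, so it converges to that point. *)
Lemma padic_expg_cvg h a : (h ^+ (a n : nat))%g @[n --> \oo] --> padic_expg h a.
Proof.
have [cG hG tdG] := G_pro_p.1; pose u n := (h ^+ (a n : nat))%g.
rewrite /padic_expg; suff [y uy] : exists y, u @ \oo --> y.
  by case: xgetP => [_ -> //|/(_ y)].
have [y [_ cy]] := cG (u @ \oo) _ (@filterT _ _ _).
exists y => A nA.
have nA1 : nbhs 1%g [set x | A (y * x)%g].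
  have : (fun x => y * x)%g @ (1%g : G) --> (y * 1)%g.
    by apply: cvg_mulg; [exact: cvg_cst|exact: cvg_id].
  by rewrite mulg1; apply.
have [N [sN nN oN NA]] := profinite_open_normal G_pro_p.1 nA1.
have [k Nk] := pro_p_expg_open_normal h sN nN oN.
(* The residues [a n] and [a k] differ by a multiple of [p ^ k.+1], and [h ^+ (p ^ k)] lies in
   [N]. *)
have uk n : (k <= n)%N -> N ((u k)^-1 * u n)%g.
  move=> kn; rewrite /u (padic_val_modX p_prime a kn).
  rewrite {2}(divn_eq (a n) (p ^ k.+1)) addnC expgnDr mulKg mulnC expgnA.
  by apply: subgroupX => //; rewrite expnSr expgnA; exact: subgroupX.
have [_ [[n kn <-] Nyn]] : [set u n | n in [set n | (k <= n)%N]] `&`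
    [set x | N (y^-1 * x)%g] !=set0.
  apply: cy; last by apply: nbhs_mulg; apply: open_nbhs_nbhs; split => //; case: sN.
  by exists k => // n kn; exists n.
exists k => // m km; rewrite /= -(mulVKg y (u m)); apply: NA.
have -> : (y^-1 * u m = y^-1 * u n * ((u k)^-1 * u n)^-1 * ((u k)^-1 * u m))%g.
  by rewrite invgM invgK !mulgA mulgK mulgK.
by apply: subgroupM => //; [apply: subgroupM => //; apply: subgroupV|] => //; exact: uk.
Qed.

End ProPGroup.

Arguments padic_expg_cvg [p] p_prime [G] G_pro_p h a [t] _.

(** * Convergence and separation in [Z_p] *)

Section PadicTopology.
Variable p : nat.

Lemma padic_cvgP T (F : set_system T) {FF : Filter F} (f : T -> padic p) (l : padic p) :
  f @ F --> l <-> forall n, \forall t \near F, f t n = l n.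
Proof.
split=> [fl n|fl A [n _ nA]]; first by apply: (fl [set y | y n = l n]); exists n.
by apply: filterS (fl n) => t ftn; apply: nA.
Qed.

Lemma padic_hausdorff : hausdorff_space (padic p).
Proof.
move=> x y cxy; apply: padic_ext => n.
have [||z [/= <- <-//]] := cxy [set z : padic p | z n = x n]
  [set z : padic p | z n = y n]; by exists n.
Qed.

Lemma padic_closed1 (x : padic p) : closed [set x].
Proof. by apply/accessible_closed_set1/hausdorff_accessible/padic_hausdorff. Qed.

End PadicTopology.

(** * Continuous homomorphisms from a closed subgroup to [Z_p] *)

Section ContinuousHom.
Variables (p : nat) (p_prime : prime p) (G : topGroupType).
Hypothesis G_pro_p : is_pro_p G p.
Variable H : set G.
Hypotheses (sH : is_subgroup H) (clH : closed H).
Implicit Types (h x y : G) (a b : padic p) (f g : G -> padic p).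

(* Continuity on [H] of a homomorphism is expressed at the identity. *)
Definition continuous_hom f : Prop :=
  (forall x y, H x -> H y -> f (x * y)%g = f x + f y) /\
  forall n, \forall x \near (1%g : G), H x -> f x n = 0.

Lemma subgroup_padic_expg h a : H h -> H (padic_expg h a).
Proof.
move=> Hh; apply: (closed_cvg H clH _ _ (padic_expg_cvg p_prime G_pro_p h a)).
by apply: nearW => n; exact: subgroupX.
Qed.

Lemma continuous_hom_lin f f' a : continuous_hom f -> continuous_hom f' ->
  continuous_hom (fun x => f x + a * f' x).
Proof.
move=> [fD fc] [gD gc]; split=> [x y Hx Hy|n].
  by rewrite fD // gD // mulrDr addrACA.
apply: filterS2 (fc n) (gc n) => x fx gx Hx.
by rewrite padic_projD padic_projM fx // gx // mulr0 addr0.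
Qed.

Section Hom.
Variable f : G -> padic p.
Hypothesis fH : continuous_hom f.

Lemma hom1 : f 1%g = 0.
Proof.
have := fH.1 1%g 1%g (subgroup1 sH) (subgroup1 sH); rewrite mulg1 => e.
by apply: (addrI (f 1%g)); rewrite -e addr0.
Qed.

Lemma homV x : H x -> f (x^-1)%g = - f x.
Proof.
move=> Hx; apply/eqP; rewrite -addr_eq0 -fH.1 //; last exact: subgroupV.
by rewrite mulVg hom1.
Qed.

Lemma homX x n : H x -> f (x ^+ n)%g = n%:R * f x.
Proof.
move=> Hx; elim: n => [|n IHn]; first by rewrite hom1 mul0r.
by rewrite expgS fH.1 //; [rewrite IHn -[in RHS]nat1r mulrDl mul1r|exact: subgroupX].
Qed.

Lemma hom_near x n : H x -> \forall y \near x, H y -> f y n = f x n.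
Proof.
move=> Hx; apply: filterS (nbhs_mulg x (fH.2 n)) => y fxy Hy.
have Hxy : H (x^-1 * y)%g by apply: subgroupM => //; exact: subgroupV.
have := fxy Hxy; rewrite fH.1 //; last exact: subgroupV.
by rewrite padic_projD homV // padic_projN addrC => /eqP; rewrite subr_eq0 => /eqP.
Qed.

(** At a large index the natural power is close to the limit, and its exponent agrees with [a] at
    level [n]. *)
Lemma hom_padic_expg h a : H h -> f (padic_expg h a) = a * f h.
Proof.
move=> Hh; apply: padic_ext => n.
have Ha := subgroup_padic_expg a Hh.
have := padic_expg_cvg p_prime G_pro_p h a (hom_near n Ha).
move=> [N _ /(_ (maxn N n) (leq_maxl _ _))].
rewrite /= => <-; last exact: subgroupX.
rewrite homX // !padic_projM padic_proj_nat; congr (_ * _).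
rewrite -[RHS]natr_Zp (padic_val_modX p_prime a (leq_maxr N n)).
by rewrite Zp_nat_mod ?expn_prime_gt1.
Qed.

(* Dividing [f] by a value of minimal valuation. *)
Lemma hom_divide x0 : H x0 -> f x0 <> 0 ->
  exists h, [/\ H h, f h <> 0 & exists2 f', continuous_hom f' &
    f' h = 1 /\ forall x, H x -> f x = f' x * f h].
Proof.
move=> Hx0 fx0.
have exn : exists n, `[< exists2 h, H h & f h n <> 0 >].
  by have [n /eqP fn] := padic_neq0P fx0; exists n; apply/asboolP; exists x0.
(* [n] is the least level at which some value of [f] on [H] is nonzero, so [f h] divides all these
   values. *)
case: (ex_minnP exn) => n /asboolP[h Hh /eqP fhn] minn {exn}.
have min0 y m : H y -> (m < n)%N -> f y m = 0.
  move=> Hy; rewrite ltnNge; apply: contraNeq => fym.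
  by apply: minn; apply/asboolP; exists y => //; exact/eqP.
have fh : f h <> 0 by move=> fh; move: fhn; rewrite fh eqxx.
have dvd y : H y -> exists c, f y = c * f h.
  by move=> Hy; apply: (padic_dvd p_prime fhn) => m mn; apply: min0.
pose f' y := xget 0 [set c | f y = c * f h].
have f'E y : H y -> f y = f' y * f h.
  by move=> /dvd[c yc]; rewrite /f'; case: xgetP => [d _ //|/(_ c)].
exists h; split => //; exists f'; split => //.
- move=> x y Hx Hy; apply: (padic_mulIf p_prime fh).
  by rewrite mulrDl -!f'E ?fH.1 //; exact: subgroupM.
(* Dividing by [f h] costs [n] levels, hence the level [m + n] for [f]. *)
- move=> m; apply: filterS (fH.2 (m + n)%N) => x fx Hx.
  by apply: (padic_mul_eq0 p_prime fhn); rewrite -f'E // fx.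
- by apply: (padic_mulIf p_prime fh); rewrite mul1r -f'E.
Qed.

End Hom.

(** Gaussian elimination over [Z_p]: the pivot [f'] takes the value 1 at [h], and the other
    homomorphisms are corrected by multiples of [f'] so as to vanish at [h]. *)
Lemma hom_elimination (s : seq (G -> padic p)) :
  {in s, forall f, continuous_hom f} ->
  exists (I : Type) (F : I -> G -> padic p),
    [/\ forall i, continuous_hom (F i),
        forall x, H x -> (forall i, F i x = 0) <-> {in s, forall f : G -> padic p, f x = 0} &
        forall t : I -> padic p, exists2 x, H x & forall i, F i x = t i].
Proof.
have [n] := ubnP (size s); elim: n s => // n IHn [|f s] /= sn sH'.
  exists False, (fun=> fun=> 0); split => //.
  by move=> t; exists 1%g; [exact: subgroup1|].
have fH : continuous_hom f by apply: sH'; exact: mem_head.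
have [[x0 Hx0 fx0]|nf] := pselect (exists2 x0, H x0 & f x0 <> 0); last first.
  have [||I [F [FH FK Ft]]] := IHn s; first by [].
    by move=> g gs; apply: sH'; rewrite inE gs orbT.
  exists I, F; split => // x Hx; rewrite FK //; split=> [sx g|sx g gs].
    rewrite inE => /orP[/eqP->|/sx //].
    by apply: contrapT => fx; apply: nf; exists x.
  by apply: sx; rewrite inE gs orbT.
have [h [Hh fh [f' f'H [f'h f'E]]]] := hom_divide fH Hx0 fx0.
pose r (g : G -> padic p) x := g x + - g h * f' x.
have [||I [F [FH FK Ft]]] := IHn [seq r g | g <- s]; first by rewrite size_map.
  move=> _ /mapP[g gs ->]; apply: continuous_hom_lin => //.
  by apply: sH'; rewrite inE gs orbT.
have Fh i : F i h = 0.
  apply: (iffRL (FK h Hh)) => _ /mapP[g gs ->].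
  by rewrite /r f'h mulr1 subrr.
exists (option I), (fun o => if o is Some i then F i else f'); split.
- by case.
- move=> x Hx; split=> [Fx g gs|sx].
    have f'x := Fx None; move: gs; rewrite inE => /orP[/eqP->|gs]; first by rewrite f'E // f'x mul0r.
    have := iffLR (FK x Hx) (fun i => Fx (Some i)) (r g) (map_f r gs).
    by rewrite /r f'x mulr0 addr0.
  have f'x : f' x = 0.
    by apply: (padic_mulf_eq0 p_prime fh); rewrite -f'E //; apply: sx; exact: mem_head.
  case=> [i|//]; apply: (iffRL (FK x Hx)) => _ /mapP[g gs ->].
  by rewrite /r f'x mulr0 addr0; apply: sx; rewrite inE gs orbT.
(* The other coordinates are solved first; a power of [h], on which they vanish, then adjusts the
   pivot coordinate. *)
- move=> t; have [y Hy Fy] := Ft (fun i => t (Some i)).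
  have Hha b := subgroup_padic_expg b Hh.
  exists (y * padic_expg h (t None - f' y))%g; first exact: subgroupM.
  case=> [i|].
    by rewrite (FH i).1 // (hom_padic_expg (FH i)) // Fh mulr0 addr0.
  by rewrite f'H.1 // (hom_padic_expg f'H) // f'h mulr1 addrC subrK.
Qed.

End ContinuousHom.

(** * The product topology on [Z_p^I] *)

Section PointwiseTopology.
Variables (I : Type) (U : topologicalType).

Lemma ptws_proj_continuous (i : I) : continuous (fun t : {ptws I -> U} => t i).
Proof. exact: (@proj_continuous {classic I} (fun=> U) i). Qed.

Lemma ptws_hausdorff : hausdorff_space U -> hausdorff_space {ptws I -> U}.
Proof. by move=> hU; apply: (@hausdorff_product {classic I} (fun=> U)). Qed.

Lemma cvg_ptws T (F : set_system T) {FF : Filter F} (f : T -> {ptws I -> U})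
    (t : {ptws I -> U}) :
  (forall i, (fun x => f x i) @ F --> t i) -> f @ F --> t.
Proof.
move=> ft; apply/cvg_sup => i A [B [[C oC <-] Ct BA]].
by apply: filterS BA _; apply: (ft i); apply: open_nbhs_nbhs.
Qed.

End PointwiseTopology.

(** [Z] stands for the module of cocycles and [s] for topological generators. At each [x] in [s]
    where some member of [Z] is nonzero, one such member is kept and [Z] is cut down to the members
    vanishing at [x]. *)
Lemma finite_common_zeros (p : nat) (p_prime : prime p) (X : eqType) (s : seq X)
    (Z : set (X -> padic p)) :
  (forall a b c d, Z c -> Z d -> Z (fun x => a * c x - b * d x)) ->
  (forall c, Z c -> {in s, forall x, c x = 0} -> forall x, c x = 0) ->
  exists2 l : seq (X -> padic p), {in l, forall c, Z c} &
    forall x, {in l, forall c : X -> padic p, c x = 0} -> forall c, Z c -> c x = 0.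
Proof.
elim: s Z => [|x s IHs] Z Zlin Zs.
  by exists [::] => // x _ c Zc; apply: Zs.
have [[c0 Zc0 c0x]|nc] := pselect (exists2 c, Z c & c x <> 0); last first.
  apply: IHs => // c Zc cs; apply: Zs => // y; rewrite inE => /orP[/eqP->|/cs //].
  by apply: contrapT => cx; apply: nc; exists c.
have [||l Zl lZ] := IHs [set c | Z c /\ c x = 0].
- move=> a b c d [Zc cx] [Zd dx]; split; first exact: Zlin.
  by rewrite cx dx !mulr0 subrr.
- move=> c [Zc cx] cs; apply: Zs => // y.
  by rewrite inE => /orP[/eqP->|/cs].
exists (c0 :: l).
  by move=> c; rewrite inE => /orP[/eqP->|/Zl[]].
move=> y ly c Zc; have c0y := ly c0 (mem_head _ _).
have {}ly : {in l, forall c : X -> padic p, c y = 0}.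
  by move=> d dl; apply: ly; rewrite inE dl orbT.
(* Cross-multiplication makes this combination vanish at [x] without dividing by [c0 x]; at [y] it
   equals [c0 x * c y], as [c0 y = 0]. *)
have := lZ y ly (fun z => c0 x * c z - c x * c0 z).
rewrite c0y mulr0 subr0 mulrC => e; apply: (padic_mulf_eq0 p_prime c0x).
by apply: e; split; [exact: Zlin | rewrite mulrC subrr].
Qed.

(** * Closed subgroups generated by a set *)

Section ClosedSubgroupGen.
Variables (G : topGroupType) (S : set G).

Lemma closed_subgroup_gen_subgroup : is_subgroup (closed_subgroup_gen S).
Proof.
split=> [H [[[]]] //|x y Sx Sy H SH].
by apply: SH.1.1.2; [exact: Sx|exact: Sy].
Qed.

Lemma sub_closed_subgroup_gen : S `<=` closed_subgroup_gen S.
Proof. exact: sub_smallest. Qed.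

Lemma closed_subgroup_gen_sub (H : set G) :
  is_subgroup H -> closed H -> S `<=` H -> closed_subgroup_gen S `<=` H.
Proof. by move=> sH cH; apply: smallest_sub. Qed.

End ClosedSubgroupGen.

(** * [Ker theta], [K] and cocycles of a cyclotomic pair *)

Section CyclotomicPair.
Variables (p : nat) (p_prime : prime p) (G : topGroupType) (theta : G -> padic p).
Hypothesis cyc : cyclotomic_pro_p_pair theta.

Local Notation H := (pair_ker theta).
Local Notation K := (pair_K theta).

Let G_pro_p : is_pro_p G p. Proof. by case: cyc. Qed.

Lemma cyclotomicM g h : theta (g * h)%g = theta g * theta h.
Proof. by case: cyc. Qed.

(** The residue of [theta g] modulo [p] is 1. *)
Lemma cyclotomic_neq0 g : theta g <> 0.
Proof.
case: cyc => _ /(_ g)[a ->] _ _ /(congr1 (fun x : padic p => x 0%N)).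
rewrite padic_projD padic_projM padic_proj_nat padic_proj0 padic_proj1.
have /eqP -> : (p%:R : 'Z_(p ^ 1)) == 0.
  by rewrite (padic_nat_eq0 p_prime 0) expn1.
by rewrite mul0r addr0 => /eqP; rewrite oner_eq0.
Qed.

Lemma cyclotomic1 : theta 1%g = 1.
Proof.
apply: (padic_mulIf p_prime (@cyclotomic_neq0 1%g)).
by rewrite -cyclotomicM mulg1 mul1r.
Qed.

Lemma cyclotomicV g : theta (g^-1)%g * theta g = 1.
Proof. by rewrite -cyclotomicM mulVg cyclotomic1. Qed.

Lemma pair_ker_subgroup : is_subgroup H.
Proof.
split=> [|x y Hx Hy]; first exact: cyclotomic1.
rewrite /pair_ker /= cyclotomicM Hx mul1r.
by have := cyclotomicV y; rewrite Hy mulr1.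
Qed.

Lemma pair_ker_closed : closed H.
Proof.
apply: (@closed_comp _ _ theta [set 1]); last exact: padic_closed1.
by move=> x _; case: cyc => _ _ _; apply.
Qed.

Lemma pair_ker_conj g h : H h -> H (g * h * g^-1)%g.
Proof.
by move=> Hh; rewrite /pair_ker /= !cyclotomicM Hh mulr1 mulrC cyclotomicV.
Qed.

Let sH := pair_ker_subgroup.
Let clH := pair_ker_closed.

Lemma pair_K_sub_ker : K `<=` H.
Proof.
apply: closed_subgroup_gen_sub => // _ [g _ [h Hh <-]].
rewrite -!mulgA; apply: subgroupM => //; last by rewrite mulgA; exact: pair_ker_conj.
exact: (subgroup_padic_expg p_prime G_pro_p sH clH).
Qed.

(** On the generator of [K] attached to [g] and [h], the value of [f] is
    [f (g * h * g^-1) - theta g * f h]. *)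
Lemma hom_pair_K f g h : continuous_hom H f -> (forall k, K k -> f k = 0) ->
  H h -> f (g * h * g^-1)%g = theta g * f h.
Proof.
move=> fH fK Hh.
have := fK (padic_expg h (- theta g) * g * h * g^-1)%g.
rewrite -!mulgA fH.1; first last.
- by rewrite mulgA; exact: pair_ker_conj.
- exact: (subgroup_padic_expg p_prime G_pro_p sH clH).
rewrite (hom_padic_expg p_prime G_pro_p sH clH fH) // mulNr => e.
apply/esym/eqP; rewrite -subr_eq0 -oppr_eq0 opprB addrC; apply/eqP/e.
by apply: sub_closed_subgroup_gen; exists g => //; exists h; rewrite // !mulgA.
Qed.

Section Cocycle.
Variable c : G -> padic p.
Hypothesis cc : continuous_cocycle theta c.

Lemma cocycle1 : c 1%g = 0.
Proof.
have := cc.2 1%g 1%g; rewrite mulg1 cyclotomic1 mul1r => e.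
by apply: (addrI (c 1%g)); rewrite -e addr0.
Qed.

Lemma cocycleV g : c (g^-1)%g = - (theta (g^-1)%g * c g).
Proof. by apply/eqP; rewrite -addr_eq0 -cc.2 mulVg cocycle1. Qed.

Lemma cocycle_zeros_subgroup : is_subgroup (c @^-1` [set 0]).
Proof.
split=> [|x y /= cx cy]; first exact: cocycle1.
by rewrite /= cc.2 cx cocycleV cy !mulr0 oppr0 mulr0 addr0.
Qed.

Lemma cocycle_zeros_closed : closed (c @^-1` [set 0]).
Proof.
by apply: closed_comp; [move=> x _; exact: cc.1 | exact: padic_closed1].
Qed.

Lemma cocycle_conj g h : H h -> c (g * h * g^-1)%g = theta g * c h.
Proof.
move=> Hh; rewrite !cc.2 cocycleV cyclotomicM Hh mulr1 mulrN mulrA.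
by rewrite (mulrC (theta g) (theta _)) cyclotomicV mul1r addrAC subrr add0r.
Qed.

Lemma cocycle_hom : continuous_hom H c.
Proof.
split=> [x y Hx _|n]; first by rewrite cc.2 Hx mul1r.
have /padic_cvgP /(_ n) := cc.1 1%g.
by apply: filterS => x; rewrite cocycle1.
Qed.

(** On a generator of [K] the two contributions [- theta g * c h] and [theta g * c h] cancel. *)
Lemma pair_K_sub_cocycle_zeros : K `<=` c @^-1` [set 0].
Proof.
suff sK : K `<=` H `&` c @^-1` [set 0] by move=> x /sK[].
apply: closed_subgroup_gen_sub.
- split; first by split; [exact: subgroup1|exact: cocycle_zeros_subgroup.1].
  by move=> x y [Hx cx] [Hy cy]; split; [exact: sH.2|exact: cocycle_zeros_subgroup.2].
- exact: closedI clH cocycle_zeros_closed.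
- move=> x Kx; split; first by apply: pair_K_sub_ker; apply: sub_closed_subgroup_gen.
  case: Kx => g _ [h Hh <-] /=.
  have Ha := subgroup_padic_expg p_prime G_pro_p sH clH (- theta g) Hh.
  rewrite -!mulgA cocycle_hom.1 //; last by rewrite mulgA; exact: pair_ker_conj.
  rewrite (hom_padic_expg p_prime G_pro_p sH clH cocycle_hom) // mulgA.
  by rewrite cocycle_conj // mulNr addNr.
Qed.

End Cocycle.

End CyclotomicPair.

(** * The two implications *)

Section Kummerian.
Variables (p : nat) (p_prime : prime p) (G : topGroupType) (theta : G -> padic p).
Hypothesis cyc : cyclotomic_pro_p_pair theta.

Local Notation H := (pair_ker theta).
Local Notation K := (pair_K theta).
Local Notation Z := (\bigcap_(c in continuous_cocycle theta) c @^-1` [set 0]).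

Let G_pro_p : is_pro_p G p. Proof. by case: cyc. Qed.
Let sH : is_subgroup H := pair_ker_subgroup p_prime cyc.
Let clH : closed H := pair_ker_closed cyc.
Let sK : is_subgroup K := closed_subgroup_gen_subgroup _.
Let KH : K `<=` H := pair_K_sub_ker p_prime cyc.
Let thetaM g h : theta (g * h)%g = theta g * theta h := cyclotomicM cyc g h.

Let sub_KZ : K `<=` Z.
Proof. by move=> x Kx c cc; exact: (pair_K_sub_cocycle_zeros p_prime cyc cc). Qed.

(** This coboundary has zero set [Ker theta], which confines [Z] to the kernel. *)
Let theta_cocycle : continuous_cocycle theta (fun g => theta g - 1).
Proof.
split=> [g|g h]; last by rewrite thetaM mulrBr mulr1 [RHS]addrC addrA subrK.
apply/padic_cvgP => n; have [_ _ _ /(_ g) /padic_cvgP /(_ n)] := cyc.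
by apply: filterS => x xg; rewrite !padic_projD xg.
Qed.

Let sub_ZH : Z `<=` H.
Proof. by move=> x /(_ _ theta_cocycle) /= /eqP; rewrite subr_eq0 => /eqP. Qed.

(* If [theta] is not trivial at [g0], then [(1 - theta g0) f] extends to the
   cocycle [f [g, g0]]. *)
Let hom_vanish (f : G -> padic p) x : continuous_hom H f -> (forall k, K k -> f k = 0) ->
  Z x -> f x = 0.
Proof.
move=> fH fK Zx; have Hx := sub_ZH Zx.
have [[g0 /eqP g0N1]|ntheta] := pselect (exists g0, theta g0 <> 1); last first.
  have HT g : H g by apply: contrapT => Hg; apply: ntheta; exists g.
  apply: (Zx f); split=> [g|g h]; last by rewrite fH.1 // HT mul1r.
  apply/padic_cvgP => n.
  by apply: filterS (hom_near sH fH n (HT g)) => y; apply.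
pose com g := (g * g0 * g^-1 * g0^-1)%g.
have Hcom g : H (com g).
  rewrite /pair_ker /= /com !thetaM (mulrAC _ (theta g0)).
  by rewrite (mulrC (theta g)) !(cyclotomicV p_prime cyc) mul1r mulrC cyclotomicV.
(* Applying the equivariant [f] to this identity gives the cocycle rule for [f \o com]. *)
have comM g h : com (g * h)%g = (g * com h * g^-1 * com g)%g.
  by rewrite /com invgM !mulgA !mulgVK.
have com_cvg g : com y @[y --> g] --> com g.
  apply: cvg_mulg; last exact: cvg_cst.
  apply: cvg_mulg; last by apply: cvg_invg; exact: cvg_id.
  by apply: cvg_mulg; [exact: cvg_id|exact: cvg_cst].
have ccom : continuous_cocycle theta (f \o com).
  split=> [g|g h] /=.
    apply/padic_cvgP => n.
    have fn : \forall y \near g, H (com y) -> f (com y) n = f (com g) n.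
      exact: (com_cvg g _ (hom_near sH fH n (Hcom g))).
    by apply: filterS fn => y /(_ (Hcom y)).
  rewrite comM fH.1 //; last exact: pair_ker_conj.
  by rewrite (hom_pair_K p_prime cyc g fH fK) // addrC.
(* Regrouped as [x] times a conjugate of [x^-1], the commutator has [f]-value
   [(1 - theta g0) * f x]. *)
have /= := Zx _ ccom; rewrite /com -!mulgA fH.1 //; last first.
  by rewrite !mulgA; apply: pair_ker_conj => //; exact: subgroupV.
rewrite mulgA (hom_pair_K p_prime cyc g0 fH fK); last exact: subgroupV.
rewrite (homV sH fH) // mulrN -{1}(mul1r (f x)) -mulrBl mulrC.
by apply: padic_mulf_eq0 => // /eqP; rewrite subr_eq0 eq_sym (negPf g0N1).
Qed.

(** The coordinates of the isomorphism vanish on [K], hence at every point of [Z] by [hom_vanish];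
    injectivity then puts that point in [K]. *)
Lemma kummerian_pair_K_zeros : kummerian theta -> K = Z.
Proof.
case=> I [F [[_ F_inj _] FD Fo]]; apply/seteqP; split; first exact: sub_KZ.
move=> x Zx; have Hx := sub_ZH Zx.
pose f i y := F (left_coset K y) i.
have fD i : forall y z, H y -> H z -> f i (y * z)%g = f i y + f i z.
  by move=> y z Hy Hz; exact: FD.
have f1 i : f i 1%g = 0.
  apply: (addrI (f i 1%g)); rewrite -fD ?addr0 ?mulg1 //; exact: subgroup1.
have fH i : continuous_hom H (f i).
  split=> [|n]; first exact: fD.
  (* Continuity at the identity comes from this open cylinder, whose preimage is open in [H]. *)
  pose V := [set t : {ptws I -> padic p} | t i n = 0].
  have oV : open V.
    apply: (@open_comp _ _ (fun t : {ptws I -> padic p} => t i) [set z : padic p | z n = 0]).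
      by move=> t _; exact: ptws_proj_continuous.
    by rewrite openE => z zn; exists n => // z' /= ->.
  have /Fo/open_subspaceP[W oW WV] := oV.
  have : nbhs 1%g W.
    apply: open_nbhs_nbhs; split => //.
    have [] : (W `&` H) 1%g by rewrite WV; split; [split; [|exact: (congr1 (fun z : padic p => z n) (f1 i))]|];
      exact: subgroup1.
    by [].
  apply: filterS => y Wy Hy.
  by have : (W `&` H) y by []; rewrite WV => -[[]].
have fK i k : K k -> f i k = 0.
  move=> Kk; rewrite -(f1 i) /f; congr (F _ i).
  by apply/left_cosetP => //; rewrite mulg1; exact: (subgroupV sK).
have fx i : f i x = 0 by apply: (hom_vanish (fH i)) => // k; exact: fK.
have /left_cosetP : left_coset K 1%g = left_coset K x.
  apply: F_inj; [apply: mem_set; exists 1%g => //; exact: subgroup1 | |].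
    by apply: mem_set; exists x.
  by apply: functional_extensionality_dep => i; rewrite -/(f i 1%g) -/(f i x) f1 fx.
by rewrite invg1 mul1g; apply.
Qed.

Lemma pair_K_zeros_kummerian : topologically_finitely_generated G ->
  K = Z -> kummerian theta.
Proof.
move=> [s sG] KZ.
have [||l lc lZ] := @finite_common_zeros p p_prime G s (continuous_cocycle theta).
- move=> a b c d cc cd; split=> [g|g h]; last first.
    rewrite cc.2 cd.2 !mulrDr opprD addrACA; congr (_ + _).
    by rewrite mulrN !mulrA (mulrC a) (mulrC b).
  apply/padic_cvgP => n.
  have /padic_cvgP/(_ n) cg := cc.1 g; have /padic_cvgP/(_ n) dg := cd.1 g.
  apply: filterS2 cg dg => x cx dx.
  by rewrite !padic_projD !padic_projN !padic_projM cx dx.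
(* A cocycle vanishing on the generators vanishes on [G], because its zero set is a closed
   subgroup. *)
- move=> c cc cs x.
  have : [set: G] `<=` c @^-1` [set 0].
    rewrite -sG; apply: closed_subgroup_gen_sub.
    + exact: (cocycle_zeros_subgroup p_prime cyc cc).
    + exact: cocycle_zeros_closed cc.
    + by move=> y /= ys; exact: cs.
  by apply.
have [c cl|I [F [FH FK Ft]]] := hom_elimination p_prime G_pro_p sH clH (s := l).
  by apply: (cocycle_hom p_prime cyc); exact: lc.
have FKP x : H x -> (forall i, F i x = 0) <-> K x.
  move=> Hx; rewrite FK // KZ; split=> [lx c|Zx c /lc]; first exact: lZ.
  exact: Zx.
have F1 i := hom1 sH (FH i).
(* Evaluation at a chosen representative; the choice is harmless on cosets of [K] in [H] since [F i]
   vanishes on [K]. The default [1] occurs only for the empty set. *)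
pose Phi (A : set G) : {ptws I -> padic p} := fun i => F i (xget 1%g A).
have PhiE x i : H x -> Phi (left_coset K x) i = F i x.
  move=> Hx; rewrite /Phi; case: xgetP => [_ _ [k Kk <-]|/(_ x) []].
    by rewrite (FH i).1 ?(iffRL (FKP k (KH Kk))) ?addr0 //; exact: KH.
  by exists 1%g; [exact: subgroup1|rewrite mulg1].
exists I, Phi; split.
- split=> [//|A B /set_mem[x Hx <-] /set_mem[y Hy <-] exy|t _].
    have HV : H (x^-1)%g by exact: subgroupV.
    apply/left_cosetP => //; apply/FKP; first exact: subgroupM.
    move=> i; rewrite (FH i).1 // (homV sH (FH i)) // -!PhiE // exy.
    by rewrite addNr.
  have [x Hx Fx] := Ft t; exists (left_coset K x); first by exists x.
  by apply: functional_extensionality_dep => i; rewrite PhiE.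
- by move=> x y Hx Hy i; rewrite !PhiE ?(FH i).1 //; exact: subgroupM.
pose phi x : {ptws I -> padic p} := fun i => F i x.
have PhiE' x : H x -> Phi (left_coset K x) = phi x.
  by move=> Hx; apply: functional_extensionality_dep => i; exact: PhiE.
have phi_cont : {within H, continuous phi}.
  apply/subspace_continuousP => x Hx; apply: cvg_ptws => i.
  apply/padic_cvgP => n; exact: (hom_near sH (FH i) n Hx).
move=> V; have -> : [set x | H x /\ V (Phi (left_coset K x))] = H `&` phi @^-1` V.
  by apply/seteqP; split => x /= [Hx]; rewrite PhiE'.
rewrite open_subspaceTI; split=> [oV|].
  exact: (iffLR (continuousP _) phi_cont).
move=> /open_subspaceP[W oW WV].
(* For the converse, [phi] maps the compact part of [H] outside [W] to a closed set, whose
   complement is [V] because [phi] maps [H] onto [Z_p^I]. *)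
have [cG hG _] := G_pro_p.1.
have clC : closed (H `&` ~` W) by apply: closedI => //; exact: open_closedC.
have cC : compact (H `&` ~` W) by exact: (subclosed_compact clC cG).
have phi_cont' : {within H `&` ~` W, continuous phi}.
  by apply: continuous_subspaceW phi_cont; exact: subIsetl.
have clV := compact_closed (ptws_hausdorff (@padic_hausdorff p))
  (continuous_compact phi_cont' cC).
rewrite -openC in clV; suff -> : V = ~` (phi @` (H `&` ~` W)) by [].
apply/seteqP; split=> [t Vt [x [Hx nWx] xt]|t nt].
  by apply: nWx; have [] : (W `&` H) x by rewrite WV; split; rewrite //= xt.
have [x Hx xt] := Ft t.
have {}xt : phi x = t by exact: functional_extensionality_dep.
apply: contrapT => nVt; apply: nt; exists x => //; split => // Ox.
by have : (W `&` H) x by []; rewrite WV /= xt => -[].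
Qed.

End Kummerian.

Theorem theorem7p7 (p : nat) (p_prime : prime p)
    (G : topGroupType) (theta : G -> padic p)
    (cyc : cyclotomic_pro_p_pair theta)
    (fg : topologically_finitely_generated G)
    (tf : pair_torsion_free theta) :
  kummerian theta <->
  pair_K theta = \bigcap_(c in continuous_cocycle theta) c @^-1` [set 0].
Proof.
split; first exact: kummerian_pair_K_zeros.
exact: pair_K_zeros_kummerian.
Qed.
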